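(* Let $G$ be a prime $\{P_5,\overline{P_5},C_5\}$-free graph that is not split. Then $G$ admits a skew-partition $(X,Y)$ such that either $G[X]$ has at least two non-trivial components, or $G[Y]$ has at least two non-trivial anti-components.
   Context: All graphs are finite and simple. $V_G$ is the vertex-set of $G$, $\overline{G}$ is the complement of $G$, and $G[X]$ is the subgraph of $G$ induced by $X\subseteq V_G$. $P_5$ is the path on five vertices and $C_5$ the cycle on five vertices. $G$ is $\mathcal{H}$-free if no induced subgraph of $G$ is isomorphic to a member of $\mathcal{H}$. A split graph is a graph whose vertex-set can be partitioned into a (possibly empty) clique and a (possibly empty) stable set. A vertex $v\notin X$ is mixed on $X$ if it has both a neighbor and a non-neighbor in $X$. A set $X\subseteq V_G$ is a homogeneous set in $G$ if no vertex of $V_G\smallsetminus X$ is mixed on $X$; it is proper if $2\le|X|\le|V_G|-1$. $G$ is prime if it has no proper homogeneous set. A graph is anti-connected if its complement is connected. A component (anti-component) of a graph is a maximal connected (anti-connected) induced subgraph; it is non-trivial if it has at least two vertices. A skew-partition of $G$ is a pair $(X,Y)$ of disjoint non-empty sets with $V_G=X\cup Y$ such that $G[X]$ is not connected and $G[Y]$ is not anti-connected. *)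

(* Defs.v *)
From mathcomp Require Import all_boot.
From Stdlib Require List.

Set Implicit Arguments.
Unset Strict Implicit.
Unset Printing Implicit Defensive.

Record sgraph := SGraph {
  vertex :> finType;
  adj : rel vertex;
  adj_sym : symmetric adj;
  adj_irr : irreflexive adj
}.

Lemma compl_sym (G : sgraph) :
  symmetric [rel x y : G | (x != y) && ~~ adj x y].
Proof. by move=> x y /=; rewrite eq_sym adj_sym. Qed.

Lemma compl_irr (G : sgraph) :
  irreflexive [rel x y : G | (x != y) && ~~ adj x y].
Proof. by move=> x /=; rewrite eqxx. Qed.

Definition compl (G : sgraph) : sgraph :=
  SGraph (@compl_sym G) (@compl_irr G).

Definition path_rel n : rel 'I_n :=
  [rel i j : 'I_n | (nat_of_ord j == i.+1) || (nat_of_ord i == j.+1)].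

Lemma path_rel_sym n : symmetric (@path_rel n).
Proof. by move=> i j; rewrite /path_rel /= orbC. Qed.

Lemma path_rel_irr n : irreflexive (@path_rel n).
Proof. by move=> i; rewrite /path_rel /= orbb; apply/negbTE; rewrite neq_ltn leqnn. Qed.

Definition P5 : sgraph := SGraph (@path_rel_sym 5) (@path_rel_irr 5).

(* [ordS] is the successor modulo 5 *)
Definition cycle5_rel : rel 'I_5 := [rel i j | (j == ordS i) || (i == ordS j)].

Lemma cycle5_rel_sym : symmetric cycle5_rel.
Proof. by move=> i j; rewrite /cycle5_rel /= orbC. Qed.

Lemma cycle5_rel_irr : irreflexive cycle5_rel.
Proof. by case=> [[|[|[|[|[|i]]]]] lti]. Qed.

Definition C5 : sgraph := SGraph cycle5_rel_sym cycle5_rel_irr.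

(* G[X] is isomorphic to H, the isomorphism being given by its inverse f,
   seen as a map into V_G with image X *)
Definition induced_iso (G : sgraph) (X : {set G}) (H : sgraph) : Prop :=
  exists f : H -> G,
    [/\ injective f, [set f u | u : H] = X
      & forall u v : H, adj (f u) (f v) = adj u v].

Definition free_of (Hs : seq sgraph) (G : sgraph) : Prop :=
  forall H : sgraph, List.In H Hs -> ~ exists X : {set G}, induced_iso X H.

Definition clique (G : sgraph) (K : {set G}) : Prop :=
  {in K &, forall x y, x != y -> adj x y}.

Definition stable (G : sgraph) (S : {set G}) : Prop :=
  {in S &, forall x y, ~~ adj x y}.

Definition split_graph (G : sgraph) : Prop :=
  exists K S : {set G},
    [/\ K :|: S = [set: G], [disjoint K & S], clique K & stable S].

Definition mixed (G : sgraph) (v : G) (X : {set G}) : Prop :=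
  [/\ v \notin X, exists2 x, x \in X & adj v x
    & exists2 y, y \in X & ~~ adj v y].

Definition homogeneous (G : sgraph) (X : {set G}) : Prop :=
  forall v : G, v \notin X -> ~ mixed v X.

Definition proper_homogeneous (G : sgraph) (X : {set G}) : Prop :=
  homogeneous X /\ 2 <= #|X| <= #|G| - 1.

Definition prime_graph (G : sgraph) : Prop :=
  ~ exists X : {set G}, proper_homogeneous X.

(* The edge relation of G[X], kept on all of V_G so that [connect] applies;
   vertices outside X are isolated. *)
Definition induced_adj (G : sgraph) (X : {set G}) : rel G :=
  [rel x y | [&& x \in X, y \in X & adj x y]].

(* Connectedness of G[X]; vacuously true for X = set0, where conventions
   differ, but below only non-empty X matter. *)
Definition conn (G : sgraph) (X : {set G}) : bool :=
  [forall x in X, forall y in X, connect (induced_adj X) x y].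

(* The complement of G[X] is the subgraph of [compl G] induced by X. *)
Definition anticonn (G : sgraph) (X : {set G}) : bool := @conn (compl G) X.

Definition components (G : sgraph) (X : {set G}) : {set {set G}} :=
  [set C : {set G} | maxset (fun D : {set G} => (D \subset X) && conn D) C].

Definition anticomponents (G : sgraph) (X : {set G}) : {set {set G}} :=
  [set C : {set G} | maxset (fun D : {set G} => (D \subset X) && anticonn D) C].

Definition nontrivial (G : sgraph) (C : {set G}) : bool := 2 <= #|C|.

Definition skew_partition (G : sgraph) (X Y : {set G}) : Prop :=
  [/\ [disjoint X & Y], X != set0, Y != set0, X :|: Y = [set: G]
    & ~~ conn X /\ ~~ anticonn Y].

(* Main.v *)
Require Import Defs.
From mathcomp Require Import all_boot.

(** If [a a'] and [b b'] induce a [2K2] in [G], take [X] maximal such that two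
    edges of [G[X]] lie in different components [A], [B] of [G[X]], and let [Y]
    be its complement.  By maximality every [y] in [Y] has neighbours in both
    [A] and [B]; as [G] is [P5]-free, [y] is mixed on at most one of them and
    complete to the other.  By primeness some vertex of [Y] is mixed on [A] and
    some vertex is mixed on [B].  A path of [compl G] inside [Y] from the first
    kind to the second, taken shortest, yields an induced [P5] (length 1 or at
    least 3) or [C5] (length 2) of [compl G]; so [Y] is not anti-connected.
    Since [C5]-free graphs without [2K2] and [C4] are split (Foldes-Hammer),
    this applies to [G] or to [compl G]. *)

Set Implicit Arguments.
Unset Strict Implicit.
Unset Printing Implicit Defensive.

(** * Induced embeddings, complements, and copies of [P5], [C5] and [2K2] *)

Definition embeds (H G : sgraph) : Prop :=
  exists2 f : H -> G, injective f & forall u v, adj (f u) (f v) = adj u v.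

Lemma free_of_embeds Hs G H : free_of Hs G -> List.In H Hs -> ~ embeds H G.
Proof.
move=> free inH [f injf fE]; apply: (free H inH).
by exists [set f u | u : H], f.
Qed.

Lemma embeds_trans H1 H2 H3 : embeds H1 H2 -> embeds H2 H3 -> embeds H1 H3.
Proof.
move=> [f injf fE] [g injg gE]; exists (g \o f) => [|u v /=]; first exact: inj_comp.
by rewrite gE fE.
Qed.

Lemma embeds_compl H G : embeds H (compl G) -> embeds (compl H) G.
Proof.
move=> [f injf fE]; exists f => // u v /=; rewrite -fE /= (inj_eq injf).
by case: eqP => [->|_] /=; rewrite ?adj_irr ?negbK.
Qed.

Lemma complK_adj (G : sgraph) (x y : G) : @adj (compl (compl G)) x y = adj x y.
Proof. by rewrite /=; case: eqP => [->|_] /=; rewrite ?adj_irr ?negbK. Qed.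

Lemma embeds_complK G : embeds (compl (compl G)) G.
Proof. by exists id => // u v; rewrite complK_adj. Qed.

(** Doubling modulo 5 sends the differences 1 and -1 of adjacent vertices to 2 and -2, those of
    distinct non-adjacent ones. *)
Lemma C5_self_compl : embeds C5 (compl C5).
Proof.
exists (fun i : 'I_5 => inord (i * 2 %% 5)) => [u v|u v].
  move/(congr1 val); rewrite /= !inordK ?ltn_mod // => E; apply: val_inj.
  by case: u v E => [[|[|[|[|[|u]]]]] ltu] [[|[|[|[|[|v]]]]] ltv].
rewrite /= /cycle5_rel /= -!val_eqE /= !inordK ?ltn_mod //.
by case: u v => [[|[|[|[|[|u]]]]] ltu] [[|[|[|[|[|v]]]]] ltv].
Qed.

(* [P5] and [C5] have no false twins, so injectivity comes for free. *)
Lemma embeds_P5 (G : sgraph) (a b c d e : G) :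
  adj a b -> adj b c -> adj c d -> adj d e ->
  ~~ adj a c -> ~~ adj a d -> ~~ adj a e -> ~~ adj b d -> ~~ adj b e ->
  ~~ adj c e -> embeds P5 G.
Proof.
move=> ab bc cd de /negbTE ac /negbTE ad /negbTE ae /negbTE bd /negbTE be /negbTE ce.
have S := @adj_sym G.
pose f (i : 'I_5) := nth a [:: a; b; c; d; e] i.
have fE (u v : 'I_5) : adj (f u) (f v) = @adj P5 u v.
  case: u v => [[|[|[|[|[|u]]]]] ltu] [[|[|[|[|[|v]]]]] ltv] //=;
  rewrite /path_rel /f /= ?adj_irr ?(ab, bc, cd, de, ac, ad, ae, bd, be, ce) //;
  by rewrite S ?(ab, bc, cd, de, ac, ad, ae, bd, be, ce).
exists f => // u v fuv.
have tw w : @adj P5 u w = @adj P5 v w by rewrite -!fE fuv.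
move: (tw (inord 0)) (tw (inord 1)) (tw (inord 2)) (tw (inord 3)) (tw (inord 4)).
rewrite /= /path_rel /= !inordK // => {tw fuv}; move=> T0 T1 T2 T3 T4.
apply: val_inj; move: T0 T1 T2 T3 T4.
by case: u v => [[|[|[|[|[|u]]]]] ltu] [[|[|[|[|[|v]]]]] ltv].
Qed.

Lemma embeds_C5 (G : sgraph) (a b c d e : G) :
  adj a b -> adj b c -> adj c d -> adj d e -> adj e a ->
  ~~ adj a c -> ~~ adj a d -> ~~ adj b d -> ~~ adj b e ->
  ~~ adj c e -> embeds C5 G.
Proof.
move=> ab bc cd de ea /negbTE ac /negbTE ad /negbTE bd /negbTE be /negbTE ce.
have S := @adj_sym G.
pose f (i : 'I_5) := nth a [:: a; b; c; d; e] i.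
have fE (u v : 'I_5) : adj (f u) (f v) = @adj C5 u v.
  case: u v => [[|[|[|[|[|u]]]]] ltu] [[|[|[|[|[|v]]]]] ltv] //=;
  rewrite /cycle5_rel /f /= ?adj_irr ?(ab, bc, cd, de, ac, ad, ea, bd, be, ce) //;
  by rewrite S ?(ab, bc, cd, de, ac, ad, ea, bd, be, ce).
exists f => // u v fuv.
have tw w : @adj C5 u w = @adj C5 v w by rewrite -!fE fuv.
move: (tw (inord 0)) (tw (inord 1)) (tw (inord 2)) (tw (inord 3)) (tw (inord 4)).
rewrite /= /cycle5_rel /= -!val_eqE /= !inordK // => {tw fuv}; move=> T0 T1 T2 T3 T4.
apply: val_inj; move: T0 T1 T2 T3 T4.
by case: u v => [[|[|[|[|[|u]]]]] ltu] [[|[|[|[|[|v]]]]] ltv].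
Qed.

(** The four vertices are automatically distinct: a common end of the two edges would be adjacent to
    an end of the other edge. *)
Definition has_2K2 (G : sgraph) : Prop := exists a a' b b' : G,
  [/\ adj a a', adj b b', ~~ adj a b & [/\ ~~ adj a b', ~~ adj a' b & ~~ adj a' b']].

Lemma has_2K2_dec (G : sgraph) : decidable (has_2K2 G).
Proof.
apply: (@decP _ [exists a : G, exists a', exists b, exists b',
  [&& adj a a', adj b b', ~~ adj a b, ~~ adj a b', ~~ adj a' b & ~~ adj a' b']]).
apply: (iffP existsP) => [[a /existsP[a' /existsP[b /existsP[b']]]]|].
  by case/and5P=> ? ? ? ? /andP[? ?]; exists a, a', b, b'.
case=> a [a' [b [b' [? ? ? [? ? ?]]]]]; exists a.
apply/existsP; exists a'; apply/existsP; exists b; apply/existsP; exists b'.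
by apply/and5P; split=> //; apply/andP.
Qed.

Lemma compl_adj (G : sgraph) (x y : G) :
  x != y -> ~~ adj x y -> @adj (compl G) x y.
Proof. by move=> /= -> ->. Qed.

Lemma compl_nadj (G : sgraph) (x y : G) : adj x y -> ~~ @adj (compl G) x y.
Proof. by move=> /= ->; rewrite andbF. Qed.

Lemma adj_neq (G : sgraph) (x y : G) : adj x y -> x != y.
Proof. by apply: contraTneq => ->; rewrite adj_irr. Qed.

(** The two diagonals of the induced 4-cycle are the edges of the [2K2]. *)
Lemma C4_compl_2K2 (G : sgraph) (x y u v : G) :
  adj x y -> adj y u -> adj u v -> adj v x -> ~~ adj x u -> ~~ adj y v ->
  x != u -> y != v -> has_2K2 (compl G).
Proof.
move=> xy yu uv vx nxu nyv xNu yNv; exists x, u, y, v.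
by split; [exact: compl_adj | exact: compl_adj | exact: compl_nadj
          | split; apply: compl_nadj; rewrite // adj_sym].
Qed.

(** * The Foldes-Hammer theorem on split graphs *)

Section FoldesHammer.

Variable G : sgraph.
Hypotheses (no2K2 : ~ has_2K2 G) (noC4 : ~ has_2K2 (compl G))
  (noC5 : ~ embeds C5 G).

Let cliqueb (K : {set G}) :=
  [forall x in K, forall y in K, (x != y) ==> adj x y].

Let cliqueP (K : {set G}) : reflect (clique K) (cliqueb K).
Proof.
apply: (iffP idP) => [/forall_inP h x y xK yK|h].
  by move/forall_inP: (h x xK) => /(_ y yK)/implyP.
by apply/forall_inP => x xK; apply/forall_inP => y yK; apply/implyP; apply: h.
Qed.

Let deg (x : G) := #|[set z | adj x z]|.

(* The standard extremal choice: a maximum clique of maximum degree sum; any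
   edge outside it can be exchanged for a better clique. *)
Let optimal (K : {set G}) := [/\ clique K,
  forall L : {set G}, clique L -> #|L| <= #|K|
  & forall L : {set G}, clique L -> #|L| = #|K| ->
      \sum_(v in L) deg v <= \sum_(v in K) deg v].

Let optimal_exists : exists K, optimal K.
Proof.
have c0 : cliqueb set0 by apply/cliqueP => x y; rewrite inE.
have [K0 K0c K0max] : exists2 K : {set G}, clique K &
    forall L : {set G}, clique L -> #|L| <= #|K|.
  case: (arg_maxnP (fun L : {set G} => #|L|) c0) => K /cliqueP Kc Kmax.
  by exists K => // L /cliqueP /Kmax.
have c1 : cliqueb K0 && (#|K0| == #|K0|) by rewrite eqxx andbT; apply/cliqueP.
case: (arg_maxnP (P := fun L : {set G} => cliqueb L && (#|L| == #|K0|))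
         (fun L : {set G} => \sum_(v in L) deg v) c1).
move=> K /andP[/cliqueP Kc /eqP KK0] Kmax; exists K; split=> // [L|L Lc LK].
  by rewrite KK0; apply: K0max.
by apply: Kmax; rewrite LK KK0 eqxx andbT; apply/cliqueP.
Qed.

Let miss_nonempty K x : optimal K -> x \notin K -> exists2 u, u \in K & ~~ adj x u.
Proof.
move=> [Kc Kmax _] xK; apply/exists_inP; apply: contraT.
rewrite negb_exists_in => /forall_inP h.
have xa v : v \in K -> adj x v by move/h; rewrite negbK.
suff /Kmax : clique (x |: K) by rewrite cardsU1 xK ltnn.
move=> v w /setU1P[->|vK] /setU1P[->|wK]; rewrite ?eqxx // => vw; last exact: Kc.
  exact: xa.
by rewrite adj_sym; apply: xa.
Qed.

(* [x] misses only [u] in [K], and [y] misses [u] too. *)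
Let exchange K x y u : optimal K -> x \notin K -> y \notin K -> adj x y ->
  u \in K -> ~~ adj x u -> ~~ adj y u ->
  (forall v, v \in K -> v != u -> adj x v) -> False.
Proof.
move=> [Kc Kmax Kdeg] xK yK xy uK nxu nyu xall.
have neqK v w : v \in K -> w \notin K -> v != w.
  by move=> vK; apply: contraNneq => <-.
(* If [y] missed only [u] as well, replacing [u] by both [x] and [y] would give a larger clique. *)
have [w [wK wu nyw]] : exists w, [/\ w \in K, w != u & ~~ adj y w].
  have [/exists_inP[w /setD1P[wu wK] nyw]|] :=
      boolP [exists w in K :\ u, ~~ adj y w].
    by exists w.
  rewrite negb_exists_in => /forall_inP h.
  have ya v : v \in K -> v != u -> adj y v.
    by move=> vK vu; have := h v; rewrite !inE vu vK negbK; apply.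
  suff /Kmax : clique (y |: (x |: K :\ u)).
    rewrite !cardsU1 !inE (negbTE xK) (negbTE yK) !andbF orbF.
    by rewrite eq_sym (negbTE (adj_neq xy)) [#|K|](cardsD1 u) uK /= !add1n ltnn.
  move=> v z /setU1P[->|/setU1P[->|/setD1P[vu vK]]]
          /setU1P[->|/setU1P[->|/setD1P[zu zK]]]; rewrite ?eqxx // => vz;
    by [exact: xall | exact: ya | rewrite adj_sym; exact: xall
       | rewrite adj_sym; exact: ya | rewrite adj_sym | exact: Kc].
have cK' : clique (x |: K :\ u).
  move=> v z /setU1P[->|/setD1P[vu vK]] /setU1P[->|/setD1P[zu zK]];
    rewrite ?eqxx // => vz;
    by [exact: xall | rewrite adj_sym; exact: xall | exact: Kc].
have cardK' : #|x |: K :\ u| = #|K|.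
  by rewrite cardsU1 !inE (negbTE xK) andbF [RHS](cardsD1 u) uK.
(* Swapping [u] for [x] keeps a maximum clique, so it cannot raise the degree sum. *)
have degxu : deg x <= deg u.
  have := Kdeg _ cK' cardK'.
  rewrite big_setU1 ?inE ?(negbTE xK) ?andbF //= [X in _ <= X](big_setD1 u) //=.
  by rewrite leq_add2r.
(* Otherwise the neighbours of [u] are neighbours of [x], properly so because of [y], against
   [degxu]. *)
have [z uz nxz] : exists2 z, adj u z & ~~ adj x z.
  apply/exists_inP; apply: contraT; rewrite negb_exists_in => /forall_inP h.
  suff : deg u < deg x by rewrite ltnNge degxu.
  apply: proper_card; apply/properP; split.
    by apply/subsetP => z; rewrite !inE => /h; rewrite negbK.
  by exists y; rewrite !inE // adj_sym.
have uw : adj u w by apply: Kc => //; rewrite eq_sym.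
have ? : adj x w by apply: xall.
(* Each case ends in a forbidden graph: the edges [xy], [uz] form a [2K2], or [x y z w] is a
   4-cycle, or [x y z u w] is a 5-cycle. *)
have [yz|nyz] := boolP (adj y z); last first.
  by case: no2K2; exists x, y, u, z.
have [wz|nwz] := boolP (adj w z).
  apply: noC4; apply: (@C4_compl_2K2 _ x y z w) => //.
  - by rewrite adj_sym.
  - by rewrite adj_sym.
  - by apply: contraNneq nxu => ->; rewrite adj_sym.
  - by rewrite eq_sym; apply: neqK.
apply: noC5; apply: (@embeds_C5 _ x y z u w) => //.
- by rewrite adj_sym.
- by rewrite adj_sym.
- by rewrite adj_sym.
Qed.

Lemma no_2K2_C4_C5_split : split_graph G.
Proof.
have [K Kopt] := optimal_exists; have [Kc Kmax _] := Kopt.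
have neqK v w : v \in K -> w \notin K -> v != w.
  by move=> vK; apply: contraNneq => <-.
exists K, (~: K); split; rewrite ?setUCr //.
  by rewrite -setI_eq0 setICr.
move=> x y; rewrite !inE => xK yK; apply/negP => xy.
(* The subsets of [K] missed by [x] and by [y] are nested: if [x] missed [u] but not [v], and [y]
   missed [v] but not [u], then [x y u v] would be an induced 4-cycle. *)
wlog sub : x y xK yK xy / forall v, v \in K -> ~~ adj x v -> ~~ adj y v.
  move=> wl.
  have [/exists_inP[u uK /andP[nxu yu]]|] :=
      boolP [exists u in K, ~~ adj x u && adj y u]; last first.
    rewrite negb_exists_in => /forall_inP h; apply: (wl x y) => // v vK nxv.
    by have := h v vK; rewrite nxv.
  apply: (wl y x) => //; first by rewrite adj_sym.
  move=> v vK nyv; apply/negP => xv; apply: noC4.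
  have uv : u != v by apply: contraTneq yu => ->.
  apply: (@C4_compl_2K2 _ x y u v) => //.
  - exact: Kc.
  - by rewrite adj_sym.
  - by rewrite eq_sym; apply: neqK.
  - by rewrite eq_sym; apply: neqK.
have [u uK nxu] := miss_nonempty Kopt xK.
have nyu := sub _ uK nxu.
(* A second vertex [v] missed by [x] is missed by [y] too, so [xy] and [uv] would form a [2K2]. *)
apply: (exchange Kopt xK yK xy uK nxu nyu) => v vK vu; apply: contraT => nxv.
case: no2K2; exists x, y, u, v; split=> //; first by apply: Kc; rewrite 1?eq_sym.
by split=> //; apply: sub.
Qed.

End FoldesHammer.

(** * Components, edges in different components, and mixed vertices *)

Lemma induced_adj_sym (G : sgraph) (X : {set G}) : symmetric (induced_adj X).
Proof. by move=> x y; rewrite /induced_adj /= adj_sym andbCA. Qed.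

Lemma induced_connect1 (G : sgraph) (X : {set G}) (x y : G) :
  x \in X -> y \in X -> adj x y -> connect (induced_adj X) x y.
Proof. by move=> xX yX xy; apply/connect1/and3P. Qed.

Definition comp (G : sgraph) (X : {set G}) (x : G) : {set G} :=
  [set z in X | connect (induced_adj X) x z].

Section Components.

Variables (G : sgraph) (X : {set G}) (x : G).
Hypothesis xX : x \in X.

Lemma comp_refl : x \in comp X x.
Proof. by rewrite inE xX connect0. Qed.

Lemma comp_subset : comp X x \subset X.
Proof. by apply/subsetP => y; rewrite inE => /andP[]. Qed.

Lemma comp_adj y z : y \in comp X x -> z \in X -> adj y z -> z \in comp X x.
Proof.
rewrite !inE => /andP[yX xy] zX yz; rewrite zX (connect_trans xy) //.
exact: induced_connect1.
Qed.

Lemma comp_neighbour y : y \in X -> adj x y -> y \in comp X x.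
Proof. exact: comp_adj comp_refl. Qed.

(** A path of [G[X]] from [x] never leaves the component; induction on its last vertex shows this,
    as prefixes are paths from [x] too. *)
Lemma comp_connect z :
  z \in comp X x -> connect (induced_adj (comp X x)) x z.
Proof.
rewrite inE => /andP[_ /connectP[p pth ->]].
elim/last_ind: p pth => [|p w IHp]; first by rewrite connect0.
rewrite rcons_path last_rcons => /andP[pth /and3P[lX wX lw]].
have lC : last x p \in comp X x.
  by rewrite inE lX; apply/connectP; exists p.
apply: connect_trans (IHp pth) _.
by apply: induced_connect1 => //; apply: comp_adj lw.
Qed.

Lemma comp_conn : conn (comp X x).
Proof.
apply/forall_inP => y yC; apply/forall_inP => z zC.
apply: connect_trans (comp_connect zC).
by rewrite (sym_connect_sym (induced_adj_sym _)) comp_connect.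
Qed.

Lemma comp_component : comp X x \in components X.
Proof.
rewrite inE; apply/maxsetP; split; first by rewrite comp_subset comp_conn.
move=> D /andP[DX Dconn] CD; apply/eqP; rewrite eqEsubset CD andbT.
apply/subsetP => z zD; rewrite inE (subsetP DX) //=.
have xD := subsetP CD _ comp_refl.
apply: connect_sub (forall_inP (forall_inP Dconn _ xD) _ zD) => u v.
by case/and3P=> uD vD uv; apply: induced_connect1; rewrite ?(subsetP DX).
Qed.

(** On a path in [G[C]] from [p] to [q], take the edge where adjacency to [y] is first lost. *)
Lemma conn_mixed_edge (C : {set G}) (y p q : G) : conn C ->
  p \in C -> adj y p -> q \in C -> ~~ adj y q ->
  exists u v, [/\ u \in C, v \in C, adj u v, adj y u & ~~ adj y v].
Proof.
move=> Cconn pC yp qC nyq.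
have /connectP[s] := forall_inP (forall_inP Cconn _ pC) _ qC.
elim: s p yp {pC} => [|r s IHs] p yp /=; first by move=> _ eqp; rewrite eqp yp in nyq.
move=> /andP[/and3P[pC rC pr] pth] qE.
by have [yr|nyr] := boolP (adj y r); [exact: IHs yr pth qE | exists p, r].
Qed.

End Components.

(** The property for which [X] is taken maximal, boolean so that [maxset] applies. Testing [a]
    against [b] suffices, since [a'] and [b'] lie in their components. *)
Definition separated_edges (G : sgraph) (X : {set G}) : bool :=
  [exists a in X, exists a' in X, exists b in X, exists b' in X,
    [&& adj a a', adj b b' & ~~ connect (induced_adj X) a b]].

Lemma separated_edgesP (G : sgraph) (X : {set G}) :
  reflect (exists a a' b b', [/\ a \in X, a' \in X, b \in X, b' \in X &
             [/\ adj a a', adj b b' & ~~ connect (induced_adj X) a b]])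
          (separated_edges X).
Proof.
apply: (iffP exists_inP) => [[a aX]|[a [a' [b [b' [aX a'X bX b'X [? ? ?]]]]]]].
  case/exists_inP=> a' a'X /exists_inP[b bX] /exists_inP[b' b'X] /and3P[? ? ?].
  by exists a, a', b, b'.
exists a => //; apply/exists_inP; exists a' => //; apply/exists_inP.
by exists b => //; apply/exists_inP; exists b' => //; apply/and3P.
Qed.

Lemma two_nontrivial_components (G : sgraph) (X : {set G}) : separated_edges X ->
  2 <= #|[set C in components X | nontrivial C]|.
Proof.
case/separated_edgesP => a [a' [b [b' [aX a'X bX b'X [aa' bb' nab]]]]].
have nt x y : x \in X -> y \in X -> adj x y ->
    comp X x \in [set C in components X | nontrivial C].
  move=> xX yX xy; rewrite inE comp_component //; apply/card_gt1P.
  exists x, y; split; [exact: comp_refl | exact: comp_neighbour | exact: adj_neq].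
apply/card_gt1P; exists (comp X a), (comp X b); split; [exact: nt aa' | exact: nt bb' |].
apply: contraNneq nab => Cab; have := comp_refl bX.
by rewrite -Cab inE => /andP[].
Qed.

Lemma has_2K2_separated_edges (G : sgraph) :
  has_2K2 G -> exists X : {set G}, separated_edges X.
Proof.
case=> a [a' [b [b' [aa' bb' nab [nab' na'b na'b']]]]].
exists [set a; a'; b; b']; apply/separated_edgesP; exists a, a', b, b'.
split; rewrite ?inE ?eqxx ?orbT //; split=> //; apply/negP.
case/connectP => p pth bE.
(* No edge joins the two pairs, so a path starting in the first pair stays there. *)
have stay z : z \in [set a; a'] ->
    path (induced_adj [set a; a'; b; b']) z p -> last z p \in [set a; a'].
  elim: p z {pth bE} => [|w p IHp] z //= zA /andP[/and3P[_ wX zw] pth].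
  apply: IHp pth; move: zA wX zw; rewrite !inE -!orbA.
  case/orP=> /eqP-> /or4P[]/eqP->; rewrite ?eqxx ?orbT //.
  - by rewrite (negbTE nab).
  - by rewrite (negbTE nab').
  - by rewrite (negbTE na'b).
  - by rewrite (negbTE na'b').
have := stay a; rewrite !inE eqxx -bE => /(_ isT pth) /orP[]/eqP ba.
  by rewrite ba adj_sym aa' in na'b.
by rewrite ba aa' in nab.
Qed.

(** Stronger than [mixed] in that the two witnesses are adjacent, as the induced paths below
    require; for connected [C] such an edge comes from [conn_mixed_edge]. *)
Definition mixing (G : sgraph) (C : {set G}) (y : G) : bool :=
  [exists u in C, exists v in C, [&& adj u v, adj y u & ~~ adj y v]].

Lemma mixingP (G : sgraph) (C : {set G}) (y : G) :
  reflect (exists u v, [/\ u \in C, v \in C, adj u v, adj y u & ~~ adj y v])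
          (mixing C y).
Proof.
apply: (iffP exists_inP) => [[u uC /exists_inP[v vC /and3P[? ? ?]]]|].
  by exists u, v.
move=> [u [v [uC vC ? ? ?]]]; exists u => //; apply/exists_inP.
by exists v => //; apply/and3P.
Qed.

Lemma nonhomogeneous_mixed (G : sgraph) (C : {set G}) : prime_graph G ->
  2 <= #|C| <= #|G| - 1 ->
  exists y p q, [/\ y \notin C, p \in C, adj y p, q \in C & ~~ adj y q].
Proof.
move=> prG cardC.
have [/exists_inP[y yC /andP[/exists_inP[p pC yp] /exists_inP[q qC nyq]]]|] :=
  boolP [exists y in ~: C, [exists p in C, adj y p] && [exists q in C, ~~ adj y q]].
  by exists y, p, q; split=> //; move: yC; rewrite inE.
rewrite negb_exists_in => /forall_inP h; case: prG; exists C; split=> // y yC.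
case=> _ [p pC yp] [q qC nyq]; have := h y; rewrite inE => /(_ yC)/negP; case.
by apply/andP; split; apply/exists_inP; [exists p | exists q].
Qed.

(** * Shortest paths of the complement of [G[Y]] between vertices mixed on [A] and on [B] *)

Section AntiPath.

Variables (G : sgraph) (A B Y : {set G}).
Hypotheses (noP5c : ~ embeds P5 (compl G)) (noC5c : ~ embeds C5 (compl G)).

Hypotheses (AB : {in A & B, forall u v, (u != v) && ~~ adj u v})
  (YA : [disjoint Y & A]) (YB : [disjoint Y & B])
  (mixA : {in Y, forall y, mixing A y -> {in B, forall v, adj y v}})
  (mixB : {in Y, forall y, mixing B y -> {in A, forall v, adj y v}})
  (completeA : {in Y, forall y, ~~ mixing A y -> {in A, forall v, adj y v}})
  (completeB : {in Y, forall y, ~~ mixing B y -> {in B, forall v, adj y v}}).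

Let cadj (x y : G) := @adj (compl G) x y.

Let at1 (y : G) := [exists c in Y, mixing A c && cadj c y].

(* Walks of length at most 2 in [compl G[Y]] suffice: a vertex first reached
   after three steps ends an induced [P5] of [compl G]. *)
Let near (y : G) := (y \in Y) &&
  [|| mixing A y, at1 y | [exists c in Y, at1 c && cadj c y]].

Let neqA c a : c \in Y -> a \in A -> c != a.
Proof. by move=> cY; apply: contraTneq => <-; rewrite (disjointFr YA). Qed.

Let neqB c b : c \in Y -> b \in B -> c != b.
Proof. by move=> cY; apply: contraTneq => <-; rewrite (disjointFr YB). Qed.

Let near_closed y z : near y -> z \in Y -> cadj y z -> near z.
Proof.
have step c : c \in Y -> mixing A c -> cadj c z -> z \in Y -> near z.
  move=> cY cA cz zY; rewrite /near zY; apply/or3P; apply: Or32.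
  by apply/exists_inP; exists c; rewrite ?cA.
have step1 c : c \in Y -> at1 c -> cadj c z -> z \in Y -> near z.
  move=> cY cA cz zY; rewrite /near zY; apply/or3P; apply: Or33.
  by apply/exists_inP; exists c; rewrite ?cA.
move=> /andP[yY ynear] zY yz; apply: contraT => nz.
case/or3P: ynear => [yA|y1|]; first by case/negP: nz; apply: (step y).
  by case/negP: nz; apply: (step1 y).
case/exists_inP => c1 c1Y /andP[c11 c1y].
have /exists_inP[c0 c0Y /andP[c0A c01]] := c11.
have [yA|nyA] := boolP (mixing A y); first by case/negP: nz; apply: (step y).
have [y1|ny1] := boolP (at1 y); first by case/negP: nz; apply: (step1 y).
have [c1A|nc1A] := boolP (mixing A c1).
  by case/negP: ny1; apply/exists_inP; exists c1; rewrite ?c1A.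
have [zA|nzA] := boolP (mixing A z); first by case/negP: nz; rewrite /near zY zA.
have /exists_inP[u uA /exists_inP[v vA /and3P[uv c0u nc0v]]] := c0A.
(* Here [c1], [y], [z] are complete to [A], so in the complement [v] sees only [c0]; any chord among
   [c0], [c1], [y], [z] would make [y] satisfy [at1] or [z] near. *)
case: noP5c; apply: (@embeds_P5 (compl G) v c0 c1 y z) => //.
- by rewrite (@adj_sym (compl G)) compl_adj // neqA.
- by apply: compl_nadj; rewrite adj_sym completeA.
- by apply: compl_nadj; rewrite adj_sym completeA.
- by apply: compl_nadj; rewrite adj_sym completeA.
- by apply: contra ny1 => c0y; apply/exists_inP; exists c0; rewrite ?c0A.
- by apply: contra nz => c0z; apply: (step c0).
- by apply: contra nz => c1z; apply: (step1 c1).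
Qed.

(** The case of length 1. Take an edge [aa'] of [A] with [c] adjacent to [a] only, and a neighbour
    [b] of [y] in [B]. As [c] is complete to [B] and [y] to [A], the complement has the induced path
    [a b a' c y]. *)
Let at1_not_mixing y : y \in Y -> at1 y -> ~~ mixing B y.
Proof.
move=> yY /exists_inP[c cY /andP[cA cy]]; apply/negP => yB.
have yallA := mixB yY yB; have callB := mixA cY cA.
have /exists_inP[b bB /exists_inP[b' b'B /and3P[bb' yb nyb']]] := yB.
have /exists_inP[a aA /exists_inP[a' a'A /and3P[aa' ca nca']]] := cA.
case: noP5c; apply: (@embeds_P5 (compl G) a b a' c y) => //.
- exact: AB.
- by rewrite (@adj_sym (compl G)); apply: AB.
- by rewrite (@adj_sym (compl G)) compl_adj // neqA.
- exact: compl_nadj.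
- by apply: compl_nadj; rewrite adj_sym.
- by apply: compl_nadj; rewrite adj_sym yallA.
- by apply: compl_nadj; rewrite adj_sym callB.
- by apply: compl_nadj; rewrite adj_sym.
- by apply: compl_nadj; rewrite adj_sym yallA.
Qed.

Let near_not_mixing y : near y -> ~~ mixing B y.
Proof.
case/andP=> yY ynear; apply/negP => yB; have yallA := mixB yY yB.
have /exists_inP[b bB /exists_inP[b' b'B /and3P[bb' yb nyb']]] := yB.
have [yA|nyA] := boolP (mixing A y).
  by rewrite (mixA yY yA b'B) in nyb'.
have [y1|ny1] := boolP (at1 y); first by have := at1_not_mixing yY y1; rewrite yB.
move: ynear; rewrite (negbTE nyA) (negbTE ny1) /=.
case/exists_inP => c1 c1Y /andP[c11 c1y].
have nc1B := at1_not_mixing c1Y c11.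
have /exists_inP[c0 c0Y /andP[c0A c01]] := c11.
have /exists_inP[a aA /exists_inP[a' a'A /and3P[aa' c0a nc0a']]] := c0A.
have nc1A : ~~ mixing A c1.
  by apply: contra ny1 => c1A; apply/exists_inP; exists c1; rewrite ?c1A.
(* The case of length 2: [a'] and [b'] are missed by [c0] and [y] and adjacent in the complement,
   closing the path [c0 c1 y] to a cycle. It is chordless since [c1] is complete to both [A] and
   [B], [c0] to [B] and [y] to [A]. *)
case: noC5c; apply: (@embeds_C5 (compl G) a' c0 c1 y b') => //.
- by rewrite (@adj_sym (compl G)) compl_adj // neqA.
- by rewrite compl_adj // neqB.
- by rewrite (@adj_sym (compl G)); apply: AB.
- by apply: compl_nadj; rewrite adj_sym completeA.
- by apply: compl_nadj; rewrite adj_sym yallA.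
- by apply: contra ny1 => c0y; apply/exists_inP; exists c0; rewrite ?c0A.
- by apply: compl_nadj; rewrite (mixA c0Y).
- by apply: compl_nadj; rewrite completeB.
Qed.

(** Nearness spreads along a complement path from [y], so it would reach [z]. *)
Lemma not_anticonn_of_mixing y z : y \in Y -> mixing A y -> z \in Y -> mixing B z ->
  ~~ anticonn Y.
Proof.
move=> yY yA zY zB; apply/negP => Yconn.
have /connectP[p pth zE] := forall_inP (forall_inP Yconn _ yY) _ zY.
suff /near_not_mixing : near z by rewrite zB.
have: near y by rewrite /near yY yA.
rewrite {}zE {yY yA zY zB}; elim: p y pth => [|w p IHp] y //=.
by move=> /andP[/and3P[_ wY yw] pth] ynear; apply: IHp pth (near_closed ynear wY yw).
Qed.

End AntiPath.

(** * The skew-partition, and passage to the complement *)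

Lemma skew_partition_2K2 (G : sgraph) : prime_graph G ->
  ~ embeds P5 G -> ~ embeds P5 (compl G) -> ~ embeds C5 (compl G) -> has_2K2 G ->
  exists X Y : {set G},
    skew_partition X Y /\ 2 <= #|[set C in components X | nontrivial C]|.
Proof.
move=> prG noP5 noP5c noC5c /has_2K2_separated_edges[X0 X0two].
have [X /maxsetP[Xtwo Xmax] _] := maxset_exists X0two.
exists X, (~: X); split; last exact: two_nontrivial_components.
have /separated_edgesP[a [a' [b [b' [aX a'X bX b'X [aa' bb' nab]]]]]] := Xtwo.
set A := comp X a; set B := comp X b.
have AX := subsetP (comp_subset X a); have BX := subsetP (comp_subset X b).
have csym := sym_connect_sym (@induced_adj_sym G X).
have nba : ~~ connect (induced_adj X) b a by rewrite csym.
have AB : {in A & B, forall u v, (u != v) && ~~ adj u v}.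
  move=> u v uA vB; suff nuv : ~~ connect (induced_adj X) u v.
    apply/andP; split; first by apply: contraNneq nuv => ->; apply: connect0.
    apply: contra nuv => uv.
    by apply: induced_connect1 uv; [exact: AX | exact: BX].
  move: uA vB; rewrite !inE => /andP[_ au] /andP[_ bv].
  apply: contra nab => uv; rewrite (connect_trans au) // (connect_trans uv) //.
  by rewrite csym.
have BA : {in B & A, forall u v, (u != v) && ~~ adj u v}.
  by move=> u v uB vA; rewrite eq_sym adj_sym AB.
(* If [y] had no neighbour in the component of [c], that component would survive in [y |: X] and
   still separate the two edges, against maximality. *)
have hit c c' d d' y : c \in X -> c' \in X -> d \in X -> d' \in X ->
    adj c c' -> adj d d' -> ~~ connect (induced_adj X) c d ->
    y \notin X -> exists2 p, p \in comp X c & adj y p.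
  move=> cX c'X dX d'X cc' dd' ncd yX.
  apply/exists_inP; apply: contraT; rewrite negb_exists_in => /forall_inP far.
  suff two : separated_edges (y |: X).
    by move: yX; rewrite -(Xmax _ two (subsetUr _ _)) setU11.
  apply/separated_edgesP; exists c, c', d, d'; split; rewrite ?inE ?cX ?c'X ?dX ?d'X ?orbT //.
  split=> //; apply: contra ncd => /connectP[p pth dE].
  suff: d \in comp X c by rewrite inE => /andP[].
  suff walk u : u \in comp X c -> path (induced_adj (y |: X)) u p ->
      last u p \in comp X c by rewrite dE walk ?comp_refl.
  elim: p u {pth dE} => [|w p IHp] u //= uC /andP[/and3P[_ wX uw] pth].
  apply: IHp pth; apply: comp_adj (uC) _ (uw).
  case/setU1P: wX => // wy; move: (far u uC).
  by rewrite -wy adj_sym uw.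
(* A vertex mixed on both sides is the middle of an induced [P5] with one edge in [C] and one in
   [D]. *)
have one (C D : {set G}) y : conn C -> conn D ->
    {in C & D, forall u v, (u != v) && ~~ adj u v} ->
    forall p q r s, p \in C -> adj y p -> q \in C -> ~~ adj y q ->
    r \in D -> adj y r -> s \in D -> ~~ adj y s -> False.
  move=> Cc Dc CD p q r s pC yp qC nyq rD yr sD nys.
  have [u [v [uC vC uv yu nyv]]] := conn_mixed_edge Cc pC yp qC nyq.
  have [u' [v' [u'D v'D uv' yu' nyv']]] := conn_mixed_edge Dc rD yr sD nys.
  have nCD i j : i \in C -> j \in D -> ~~ adj i j.
    by move=> iC jD; have /andP[] := CD i j iC jD.
  by case: noP5; apply: (@embeds_P5 G v u y u' v') => //;
    by [exact: nCD | rewrite adj_sym].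
have Ac : conn A := comp_conn X a; have Bc : conn B := comp_conn X b.
have hitA y : y \in ~: X -> exists2 p, p \in A & adj y p.
  by rewrite inE; apply: hit aa' bb' nab.
have hitB y : y \in ~: X -> exists2 p, p \in B & adj y p.
  by rewrite inE; apply: hit bb' aa' nba.
have disjX (C : {set G}) : C \subset X -> [disjoint ~: X & C].
  by rewrite disjoints_subset setCS.
have complete (C : {set G}) y : conn C -> (exists2 p, p \in C & adj y p) ->
    ~~ mixing C y -> {in C, forall v, adj y v}.
  move=> Cc [p pC yp] nmix v vC; apply: contraT => nyv; case/negP: nmix.
  exact/mixingP/(conn_mixed_edge Cc pC yp vC nyv).
have mixed_one (C D : {set G}) y : conn C -> conn D ->
    {in C & D, forall u v, (u != v) && ~~ adj u v} ->
    (exists2 p, p \in D & adj y p) -> mixing C y -> {in D, forall v, adj y v}.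
  move=> Cc Dc CD [p pD yp] /mixingP[u [v [uC vC _ yu nyv]]] s sD.
  by apply: contraT => nys; case: (one C D y Cc Dc CD u v p s).
have mixes c c' d : c \in X -> c' \in X -> d \in X -> adj c c' ->
    ~~ connect (induced_adj X) c d -> exists2 y, y \in ~: X & mixing (comp X c) y.
  move=> cX c'X dX cc' ncd.
  have [|y [p [q [yC pC yp qC nyq]]]] := @nonhomogeneous_mixed G (comp X c) prG.
    apply/andP; split.
      apply/card_gt1P; exists c, c'.
      by split; [exact: comp_refl | exact: comp_neighbour | exact: adj_neq].
    (* The vertex [d] outside the component gives the upper bound in properness. *)
    rewrite subn1 -ltnS prednK; last by apply/card_gt0P; exists c.
    rewrite -cardsT; apply: proper_card; apply/properP; split; first exact: subsetT.
    by exists d; rewrite !inE // dX (negbTE ncd).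
  exists y; last first.
    exact/mixingP/(conn_mixed_edge (comp_conn X c) pC yp qC nyq).
  (* A vertex of [X] with a neighbour in the component would belong to it. *)
  rewrite inE; apply: contra yC => yX; apply: comp_adj pC yX _.
  by rewrite adj_sym.
have [y yY yA] := mixes a a' b aX a'X bX aa' nab.
have [z zY zB] := mixes b b' a bX b'X aX bb' nba.
split; [|by apply/set0Pn; exists a | by apply/set0Pn; exists y | exact: setUCr | split].
- by rewrite -setI_eq0 setICr.
- apply: contra nab => Xc; exact: (forall_inP (forall_inP Xc _ aX) _ bX).
apply: (@not_anticonn_of_mixing G A B (~: X) noP5c noC5c) yY yA zY zB => //.
- exact/disjX/comp_subset.
- exact/disjX/comp_subset.
- by move=> w wY; apply: mixed_one (hitB w wY).
- by move=> w wY; apply: mixed_one (hitA w wY).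
- by move=> w wY; apply: complete (hitA w wY).
- by move=> w wY; apply: complete (hitB w wY).
Qed.

(** Complementing swaps neighbours and non-neighbours of a vertex outside [C], so being mixed on [C]
    is unchanged. *)
Lemma prime_compl G : prime_graph G -> prime_graph (compl G).
Proof.
move=> prG [C [homC cardC]]; apply: prG; exists C; split=> // v vC.
have vN x : x \in C -> v != x by move=> xC; apply: contraNneq vC => ->.
move=> [_ [x xC vx] [y yC nvy]]; apply: (homC v vC); split=> //.
  by exists y => //; apply: compl_adj => //; apply: vN.
by exists x => //; apply: compl_nadj.
Qed.

Lemma anticonn_compl (G : sgraph) (X : {set G}) : @anticonn (compl G) X = conn X.
Proof.
rewrite /anticonn /conn; apply: eq_forallb => x; congr (_ ==> _).
apply: eq_forallb => y; congr (_ ==> _); apply: eq_connect => u v.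
by congr [&& _, _ & _]; apply: complK_adj.
Qed.

Theorem mainTheorem3 (G : sgraph) :
  prime_graph G ->
  free_of [:: P5; compl P5; C5] G ->
  ~ split_graph G ->
  exists X Y : {set G},
    skew_partition X Y /\
    (2 <= #|[set C in components X | nontrivial C]| \/
     2 <= #|[set C in anticomponents Y | nontrivial C]|).
Proof.
move=> prG freeG nsplit.
have noP5 : ~ embeds P5 G by apply: (free_of_embeds freeG); left.
have noP5c : ~ embeds P5 (compl G).
  by move/embeds_compl; apply: (free_of_embeds freeG); right; left.
have noC5 : ~ embeds C5 G by apply: (free_of_embeds freeG); right; right; left.
have noC5c : ~ embeds C5 (compl G).
  by move/embeds_compl/(embeds_trans C5_self_compl).
have [G2|nG2] := has_2K2_dec G.
  have [X [Y [XY cX]]] := skew_partition_2K2 prG noP5 noP5c noC5c G2.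
  by exists X, Y; split; last left.
have [G2|nG2c] := has_2K2_dec (compl G); last first.
  by case: nsplit; apply: no_2K2_C4_C5_split.
have [X [Y [[XY X0 Y0 XYT [Xc Yc]] cX]]] :
    exists X Y : {set compl G},
      skew_partition X Y /\ 2 <= #|[set C in components X | nontrivial C]|.
  apply: skew_partition_2K2 G2 => //; first exact: prime_compl.
    by move/embeds_trans/(_ (@embeds_complK G)).
  by move/embeds_trans/(_ (@embeds_complK G)).
(* The sides swap: components of [X] in [compl G] are by definition its anti-components in [G]. *)
exists (Y : {set G}), (X : {set G}); split; last by right.
split=> //; first by rewrite disjoint_sym.
  by rewrite setUC.
by rewrite -anticonn_compl.
Qed.
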